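(* Let $F=(F_c)_c$ be a factor, $X_c=F_cF_c^\top$, let $y_{\mathrm{base}}\in\mathbb R^m$, $\rho>0$, and let $y_{\mathrm{out}}=y_{\mathrm{base}}-\rho c(F)$. Suppose $$\|c(F)\|_2\le\delta_{\mathrm{feas}},\qquad \|\nabla\Phi_{\rho,y_{\mathrm{base}}}(F)\|_\oplus\le\omega,\qquad S_c(y_{\mathrm{out}})\succeq-\tau_{\mathrm{dual}}I_{n_c}\ (c\in[q]),\qquad \|F\|_\oplus\le R_F .$$ Then $((X_c)_c,y_{\mathrm{out}})$ is $\bigl(\delta_{\mathrm{feas}},\ \tfrac{R_F\omega}{2},\ \tau_{\mathrm{dual}}\bigr)$-approximately optimal for the product SDP.
   Context: Let $q,m,n_1,\dots,n_q,k_1,\dots,k_q$ be positive integers, $[q]=\{1,\dots,q\}$, $\mathbb S^n$ the real symmetric $n\times n$ matrices. Fix $b\in\mathbb R^m$, $C_c\in\mathbb S^{n_c}$ and linear maps $\mathcal A_c:\mathbb S^{n_c}\to\mathbb R^m$ with adjoints $\mathcal A_c^*$; $S_c(y):=C_c-\mathcal A_c^*(y)$. The product SDP is $\min\sum_c\langle C_c,X_c\rangle$ s.t. $\sum_c\mathcal A_c(X_c)=b$, $X_c\succeq0$. Factors: $F=(F_c)_c$, $F_c\in\mathbb R^{n_c\times k_c}$, $\|F\|_\oplus^2:=\sum_c\|F_c\|_F^2$; $c(F):=\sum_c\mathcal A_c(F_cF_c^\top)-b$; $\Phi_{\rho,y}(F):=\sum_c\langle C_c,F_cF_c^\top\rangle-\langle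 y,c(F)\rangle+\frac\rho2\|c(F)\|_2^2$, with gradient in the direct-sum Euclidean factor space. A pair $((X_c)_c,\lambda)$ is $(\varepsilon_0,\varepsilon_1,\varepsilon_2)$-approximately optimal for the product SDP if $X_c\succeq0$ for all $c$, $\|\sum_c\mathcal A_c(X_c)-b\|_2\le\varepsilon_0$, $\bigl(\sum_c\|S_c(\lambda)X_c\|_F^2\bigr)^{1/2}\le\varepsilon_1$, and $S_c(\lambda)\succeq-\varepsilon_2I_{n_c}$ for all $c\in[q]$. *)

(* Defs.v *)
From HB Require Import structures.
From mathcomp Require Import all_boot all_order all_algebra.
From mathcomp Require Import boolp classical_sets reals.
From mathcomp Require Import ring lra.

Set Implicit Arguments.
Unset Strict Implicit.
Unset Printing Implicit Defensive.

Import Order.TTheory GRing.Theory Num.Theory.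

Local Open Scope ring_scope.

(* On column vectors this is the dot product. *)
Definition mxdot (R : realType) (p r : nat) (A B : 'M[R]_(p, r)) : R :=
  \tr (A^T *m B).

(* The norm `|A| provided by the library on matrices is the sup norm, hence
   this separate definition; on 'cV[R]_m it is the Euclidean norm. *)
Definition frob (R : realType) (p r : nat) (A : 'M[R]_(p, r)) : R :=
  Num.sqrt (mxdot A A).

Lemma mxdotE (R : realType) (p r : nat) (A B : 'M[R]_(p, r)) :
  mxdot A B = \sum_i \sum_j A i j * B i j.
Proof.
rewrite /mxdot /mxtrace exchange_big /=; apply: eq_bigr => j _.
by rewrite mxE; apply: eq_bigr => i _; rewrite mxE.
Qed.

(* The R-module S^n of real symmetric matrices. *)

Lemma symmetricmxP (R : realType) (n : nat) (A : 'M[R]_n) :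
  reflect (A^T = A) (A \is symmetricmx).
Proof.
rewrite qualifE /= expr0 scale1r map_mx_id //.
by apply: (iffP eqP) => [<-|->].
Qed.

Record symmx (R : realType) (n : nat) := SymMx {
  symmx_val :> 'M[R]_n;
  symmxP : symmx_val \is symmetricmx }.

HB.instance Definition _ (R : realType) (n : nat) := [isSub for @symmx_val R n].
HB.instance Definition _ (R : realType) (n : nat) := [Choice of symmx R n by <:].

Fact symmetricmx_submod (R : realType) (n : nat) :
  GRing.submod_closed [pred A : 'M[R]_n | A \is symmetricmx].
Proof.
split=> [|a A B]; rewrite !inE.
  by apply/symmetricmxP; rewrite trmx0.
move=> /symmetricmxP hA /symmetricmxP hB; apply/symmetricmxP.
by rewrite linearP /= hA hB.
Qed.

HB.instance Definition _ (R : realType) (n : nat) :=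
  GRing.SubChoice_isSubLmodule.Build R 'M[R]_n
    [pred A : 'M[R]_n | A \is symmetricmx] (symmx R n)
    (@symmetricmx_submod R n).

Fact symmx_val_is_linear (R : realType) (n : nat) :
  linear (@symmx_val R n).
Proof. by move=> a X Y; rewrite -[LHS]/(val _) linearP. Qed.

HB.instance Definition _ (R : realType) (n : nat) :=
  GRing.isLinear.Build R (symmx R n) 'M[R]_n *:%R (@symmx_val R n)
    (@symmx_val_is_linear R n).

Fact sym1_subproof (R : realType) (n : nat) :
  (1%:M : 'M[R]_n) \is symmetricmx.
Proof. by apply/symmetricmxP; rewrite trmx1. Qed.

Definition sym1 (R : realType) (n : nat) : symmx R n :=
  SymMx (sym1_subproof R n).

Fact gram_subproof (R : realType) (n k : nat) (F : 'M[R]_(n, k)) :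
  F *m F^T \is symmetricmx.
Proof. by apply/symmetricmxP; rewrite trmx_mul trmxK. Qed.

Definition gram (R : realType) (n k : nat) (F : 'M[R]_(n, k)) : symmx R n :=
  SymMx (gram_subproof F).

Definition psd (R : realType) (n : nat) (X : symmx R n) : Prop :=
  forall v : 'cV[R]_n, 0 <= mxdot v (X *m v).

Definition loewner_le (R : realType) (n : nat) (X Y : symmx R n) : Prop :=
  psd (Y - X).

Definition is_adjoint (R : realType) (n m : nat)
    (A : symmx R n -> 'cV[R]_m) (B : 'cV[R]_m -> symmx R n) : Prop :=
  forall (X : symmx R n) (y : 'cV[R]_m), mxdot (A X) y = mxdot X (B y).

Definition adjoint (R : realType) (n m : nat)
    (A : {linear symmx R n -> 'cV[R]_m}) : 'cV[R]_m -> symmx R n :=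
  xget (fun=> 0) [set B | is_adjoint A B].

(* q blocks; block c consists of symmetric matrices of size n c. *)
Record product_sdp (R : realType) (q m : nat) (n : 'I_q -> nat) := ProductSDP {
  sdp_C : forall c : 'I_q, symmx R (n c);
  sdp_A : forall c : 'I_q, {linear symmx R (n c) -> 'cV[R]_m};
  sdp_b : 'cV[R]_m }.

Definition slack (R : realType) (q m : nat) (n : 'I_q -> nat)
    (P : product_sdp R m n) (y : 'cV[R]_m) (c : 'I_q) : symmx R (n c) :=
  sdp_C P c - adjoint (sdp_A P c) y.

(* Direct sum over c of the spaces of n c x k c matrices. *)
Definition dsum (R : realType) (q : nat) (n k : 'I_q -> nat) : Type :=
  forall c : 'I_q, 'M[R]_(n c, k c).

Definition dsdot (R : realType) (q : nat) (n k : 'I_q -> nat)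
    (F G : dsum R n k) : R :=
  \sum_c mxdot (F c) (G c).

Definition dsnorm (R : realType) (q : nat) (n k : 'I_q -> nat)
    (F : dsum R n k) : R :=
  Num.sqrt (\sum_c frob (F c) ^+ 2).

(* G represents, for the inner product dsdot, the Frechet derivative of f
   at F. *)
Definition is_gradient (R : realType) (q : nat) (n k : 'I_q -> nat)
    (f : dsum R n k -> R) (F G : dsum R n k) : Prop :=
  forall e : R, 0 < e -> exists2 d : R, 0 < d &
    forall H : dsum R n k, dsnorm H <= d ->
      `| f (fun c => F c + H c) - f F - dsdot G H | <= e * dsnorm H.

(* The value is irrelevant (zero) where f is not differentiable. *)
Definition gradient (R : realType) (q : nat) (n k : 'I_q -> nat)
    (f : dsum R n k -> R) (F : dsum R n k) : dsum R n k :=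
  xget ((fun c => 0) : forall c : 'I_q, 'M[R]_(n c, k c))
    [set G | is_gradient f F G].

Definition infeas (R : realType) (q m : nat) (n k : 'I_q -> nat)
    (P : product_sdp R m n) (F : dsum R n k) : 'cV[R]_m :=
  \sum_c sdp_A P c (gram (F c)) - sdp_b P.

Definition auglag (R : realType) (q m : nat) (n k : 'I_q -> nat)
    (P : product_sdp R m n) (rho : R) (y : 'cV[R]_m) (F : dsum R n k) : R :=
  \sum_c mxdot (sdp_C P c) (gram (F c)) - mxdot y (infeas P F)
    + rho / 2 * frob (infeas P F) ^+ 2.

Definition approx_optimal (R : realType) (q m : nat) (n : 'I_q -> nat)
    (P : product_sdp R m n) (e0 e1 e2 : R)
    (X : forall c : 'I_q, symmx R (n c)) (lambda : 'cV[R]_m) : Prop :=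
  [/\ forall c, loewner_le 0 (X c),
      frob (\sum_c sdp_A P c (X c) - sdp_b P) <= e0,
      Num.sqrt (\sum_c frob (slack P lambda c *m X c) ^+ 2) <= e1
    & forall c, loewner_le (- e2 *: sym1 R (n c)) (slack P lambda c)].

(* adjoint always is an adjoint, and gradient is the gradient when it exists. *)

Lemma mxdotDl (R : realType) (p r : nat) (A B C : 'M[R]_(p, r)) :
  mxdot (A + B) C = mxdot A C + mxdot B C.
Proof. by rewrite /mxdot linearD /= mulmxDl linearD. Qed.

Lemma mxdotZl (R : realType) (p r : nat) (a : R) (A C : 'M[R]_(p, r)) :
  mxdot (a *: A) C = a * mxdot A C.
Proof. by rewrite /mxdot linearZ /= -scalemxAl linearZ. Qed.

Lemma mxdotC (R : realType) (p r : nat) (A B : 'M[R]_(p, r)) :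
  mxdot A B = mxdot B A.
Proof. by rewrite /mxdot -mxtrace_tr trmx_mul trmxK. Qed.

Lemma mxdot_ge0 (R : realType) (p r : nat) (A : 'M[R]_(p, r)) :
  0 <= mxdot A A.
Proof.
by rewrite mxdotE; do 2!apply: sumr_ge0 => ? _; rewrite -expr2 sqr_ge0.
Qed.

Lemma mxdot_eq0 (R : realType) (p r : nat) (A : 'M[R]_(p, r)) :
  mxdot A A = 0 -> A = 0.
Proof.
have s0 (i : 'I_p) : 0 <= \sum_j A i j * A i j.
  by apply: sumr_ge0 => j _; rewrite -expr2 sqr_ge0.
rewrite mxdotE => h; apply/matrixP => i j; rewrite mxE.
have /eqP := h; rewrite psumr_eq0 // => /allP /(_ i (mem_index_enum _)) /=.
rewrite psumr_eq0 => [|l _]; last by rewrite -expr2 sqr_ge0.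
move=> /allP /(_ j (mem_index_enum _)) /=.
by rewrite mulf_eq0 orbb => /eqP.
Qed.

Lemma adjointP (R : realType) (n m : nat)
  (A : {linear symmx R n -> 'cV[R]_m}) : is_adjoint A (adjoint A).
Proof.
rewrite /adjoint; case: xgetP => [B -> //|none].
pose sE (i j : 'I_n) : 'M[R]_n := 2^-1 *: (delta_mx i j + delta_mx j i).
have sEs i j : sE i j \is symmetricmx.
  by apply/symmetricmxP; rewrite linearZ linearD /= !trmx_delta addrC.
pose W (y : 'cV[R]_m) : 'M[R]_n :=
  \matrix_(i, j) mxdot (A (SymMx (sEs i j))) y.
have Ws y : W y \is symmetricmx.
  apply/symmetricmxP/matrixP => i j; rewrite !mxE; congr (mxdot (A _) y).
  by apply: val_inj; rewrite /= /sE addrC.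
exfalso; apply: (none (fun y => SymMx (Ws y))) => X y.
have XE : X = \sum_i \sum_j X i j *: SymMx (sEs i j).
  apply: val_inj; rewrite /= raddf_sum /=.
  under eq_bigr do rewrite raddf_sum /=.
  rewrite /sE.
  under eq_bigr do under eq_bigr do rewrite scalerA mulrC -scalerA scalerDr.
  under eq_bigr do rewrite -scaler_sumr big_split /=.
  rewrite -scaler_sumr big_split /= -matrix_sum_delta.
  have -> : \sum_i \sum_j X i j *: delta_mx j i = X :> 'M[R]_n.
    rewrite exchange_big [RHS]matrix_sum_delta /=.
    do 2!apply: eq_bigr => ? _; congr (_ *: _).
    by rewrite -{1}(symmetricmxP _ (symmxP X)) mxE.
  by rewrite -mulr2n -scaler_nat scalerA mulVf ?scale1r ?pnatr_eq0.
rewrite [RHS]mxdotE {1}XE linear_sum mxdotC /=.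
have lin_sum (I : finType) (f : I -> 'cV[R]_m) :
    mxdot y (\sum_i f i) = \sum_i mxdot y (f i).
  by rewrite /mxdot mulmx_sumr linear_sum.
rewrite lin_sum; apply: eq_bigr => i _.
rewrite linear_sum lin_sum /=; apply: eq_bigr => j _.
by rewrite linearZ mxdotC mxdotZl mxE.
Qed.

Lemma dsnorm_sq (R : realType) (q : nat) (n k : 'I_q -> nat)
  (F : dsum R n k) : dsnorm F ^+ 2 = dsdot F F.
Proof.
rewrite /dsnorm sqr_sqrtr; last by apply: sumr_ge0 => c _; exact: sqr_ge0.
by apply: eq_bigr => c _; rewrite sqr_sqrtr // mxdot_ge0.
Qed.

Lemma gradient_unique (R : realType) (q : nat) (n k : 'I_q -> nat)
  (f : dsum R n k -> R) (F G : dsum R n k) :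
  is_gradient f F G -> gradient f F = G.
Proof.
move=> hG; rewrite /gradient; case: xgetP => [K _ hK|/(_ G) //].
pose D : dsum R n k := fun c => K c - G c.
have D0 : dsnorm D = 0.
  apply/eqP; rewrite eq_le sqrtr_ge0 andbT leNgt; apply/negP => Dgt0.
  have e0 : 0 < dsnorm D / 4 by rewrite divr_gt0.
  have [d1 d1_gt0 h1] := hK _ e0; have [d2 d2_gt0 h2] := hG _ e0.
  pose t := Num.min d1 d2 / dsnorm D.
  have t_gt0 : 0 < t by rewrite divr_gt0 // lt_min d1_gt0.
  pose H : dsum R n k := fun c => t *: D c.
  have HD : dsdot D H = t * dsnorm D ^+ 2.
    rewrite dsnorm_sq /dsdot mulr_sumr; apply: eq_bigr => c _.
    by rewrite mxdotC mxdotZl.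
  have nH : dsnorm H = t * dsnorm D.
    apply/eqP; rewrite -(@eqrXn2 _ 2) ?sqrtr_ge0 //; last first.
      by rewrite mulr_ge0 ?sqrtr_ge0 // ltW.
    rewrite exprMn !dsnorm_sq /dsdot mulr_sumr; apply/eqP/eq_bigr => c _.
    by rewrite mxdotZl mxdotC mxdotZl mulrA -expr2.
  have nHE : dsnorm H = Num.min d1 d2 by rewrite nH divfK // gt_eqF.
  have := h1 H; have := h2 H; rewrite nHE ge_min lexx orbT => /(_ isT) + /(_ _).
  rewrite ge_min lexx /= => + /(_ isT); rewrite -nHE nH.
  have : dsdot K H - dsdot G H = t * dsnorm D ^+ 2.
    rewrite -HD /dsdot -sumrB; apply: eq_bigr => c _.
    by rewrite /D mxdotDl -scaleN1r mxdotZl mulN1r.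
  have := mulr_gt0 t_gt0 (exprn_gt0 2 Dgt0).
  set a := dsdot K H; set b := dsdot G H; set x := f _ - f F.
  rewrite !ler_norml => p0 ab /andP[+ +] /andP[+ +].
  have -> : dsnorm D / 4 * (t * dsnorm D) = t * dsnorm D ^+ 2 / 4 by field.
  lra.
apply: functional_extensionality_dep => c; apply/eqP; rewrite -subr_eq0.
apply/eqP/mxdot_eq0/eqP; have /eqP := dsnorm_sq D.
rewrite D0 expr0n /= eq_sym psumr_eq0 => [|i _]; last exact: mxdot_ge0.
by move=> /allP /(_ c (mem_index_enum _)).
Qed.

(* Main.v *)
Require Import Defs.
From mathcomp Require Import all_boot all_order all_algebra.
From mathcomp Require Import reals.
From mathcomp Require Import ring lra.

Set Implicit Arguments.
Unset Strict Implicit.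
Unset Printing Implicit Defensive.

Import Order.TTheory GRing.Theory Num.Theory.

Local Open Scope ring_scope.

(** The gradient of the augmented Lagrangian determines the complementarity
    residual.  With D_c = (F_c + H_c)(F_c + H_c)^T - F_c F_c^T, completing the
    expansion of the quadratic penalty around c(F) gives the exact identity
    (auglag_increment)

      Phi(F + H) - Phi(F)
        = sum_c <S_c(y_out), D_c> + rho/2 |sum_c A_c(D_c)|^2,

    because the first-order multiplier of c is y_base - rho c(F) = y_out.
    Since S_c(y_out) is symmetric, the part of <S_c(y_out), D_c> that is linear
    in H_c is <2 S_c(y_out) F_c, H_c>, and everything else is O(|H|^2).  Hence
    the gradient has blocks 2 S_c(y_out) F_c (gradient_auglag), and

      |S_c(y_out) X_c| = |S_c(y_out) F_c F_c^T| <= |gradient_c| |F_c| / 2.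

    Summing the squares over c bounds the residual by |F| |gradient| / 2.
    Positive semidefiniteness of X_c = F_c F_c^T is automatic, and the two
    remaining conditions of approximate optimality are assumed.

    The O(|H|^2) bound needs only that the Frobenius norm is submultiplicative
    (frobM) and that each A_c is bounded (frob_linear_le); both come from the
    Cauchy-Schwarz inequality. *)

(** * The Frobenius norm *)

Lemma mxdotDr (R : realType) (p r : nat) (A B C : 'M[R]_(p, r)) :
  mxdot C (A + B) = mxdot C A + mxdot C B.
Proof. by rewrite mxdotC mxdotDl !(mxdotC _ C). Qed.

Lemma mxdotZr (R : realType) (p r : nat) (a : R) (A C : 'M[R]_(p, r)) :
  mxdot C (a *: A) = a * mxdot C A.
Proof. by rewrite mxdotC mxdotZl mxdotC. Qed.

Lemma mxdotBl (R : realType) (p r : nat) (A B C : 'M[R]_(p, r)) :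
  mxdot (A - B) C = mxdot A C - mxdot B C.
Proof. by rewrite -scaleN1r mxdotDl mxdotZl mulN1r. Qed.

Lemma mxdotBr (R : realType) (p r : nat) (A B C : 'M[R]_(p, r)) :
  mxdot C (A - B) = mxdot C A - mxdot C B.
Proof. by rewrite mxdotC mxdotBl !(mxdotC _ C). Qed.

Lemma mxdot_sumr (R : realType) (p r : nat) (I : finType)
    (C : 'M[R]_(p, r)) (f : I -> 'M[R]_(p, r)) :
  mxdot C (\sum_i f i) = \sum_i mxdot C (f i).
Proof. by rewrite /mxdot mulmx_sumr linear_sum. Qed.

Lemma frob_ge0 (R : realType) (p r : nat) (A : 'M[R]_(p, r)) : 0 <= frob A.
Proof. exact: sqrtr_ge0. Qed.

Lemma frob_sq (R : realType) (p r : nat) (A : 'M[R]_(p, r)) :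
  frob A ^+ 2 = mxdot A A.
Proof. by rewrite sqr_sqrtr // mxdot_ge0. Qed.

Lemma frob0 (R : realType) (p r : nat) : frob (0 : 'M[R]_(p, r)) = 0.
Proof. by rewrite /frob /mxdot mulmx0 linear0 sqrtr0. Qed.

Lemma frob_trmx (R : realType) (p r : nat) (A : 'M[R]_(p, r)) :
  frob A^T = frob A.
Proof. by rewrite /frob /mxdot trmxK mxtrace_mulC. Qed.

Lemma mxdot_CauchySchwarz (R : realType) (p r : nat) (A B : 'M[R]_(p, r)) :
  mxdot A B ^+ 2 <= mxdot A A * mxdot B B.
Proof.
have := mxdot_ge0 B; rewrite le_eqVlt => /orP[/eqP/esym h|B_gt0].
  by rewrite h (mxdot_eq0 h) /mxdot mulmx0 linear0 expr0n mulr0.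
(* The vector used here is |B|^2 times the component of A orthogonal to B. *)
have := mxdot_ge0 (mxdot B B *: A - mxdot A B *: B).
rewrite mxdotBl !mxdotBr !mxdotZl !mxdotZr (mxdotC B A).
set a := mxdot A A; set b := mxdot B B in B_gt0 *; set c := mxdot A B.
have -> : b * (b * a) - b * (c * c) - (c * (b * c) - c * (c * b))
          = b * (a * b - c ^+ 2) by ring.
by rewrite pmulr_rge0 // subr_ge0.
Qed.

Lemma normr_mxdot_le (R : realType) (p r : nat) (A B : 'M[R]_(p, r)) :
  `|mxdot A B| <= frob A * frob B.
Proof.
rewrite -(@ler_pXn2r _ 2) ?nnegrE ?mulr_ge0 ?frob_ge0 //.
by rewrite real_normK ?num_real // exprMn !frob_sq mxdot_CauchySchwarz.
Qed.

Lemma frobD (R : realType) (p r : nat) (A B : 'M[R]_(p, r)) :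
  frob (A + B) <= frob A + frob B.
Proof.
rewrite -(@ler_pXn2r _ 2) ?nnegrE ?addr_ge0 ?frob_ge0 //.
rewrite frob_sq mxdotDl !mxdotDr (mxdotC B A) sqrrD !frob_sq.
have := le_trans (ler_norm _) (normr_mxdot_le A B); lra.
Qed.

Lemma frob_sum (R : realType) (p r : nat) (I : finType)
    (f : I -> 'M[R]_(p, r)) :
  frob (\sum_i f i) <= \sum_i frob (f i).
Proof.
elim/big_ind2: _ => [|x A y B hA hB|//]; first by rewrite frob0.
exact: le_trans (frobD _ _) (lerD hA hB).
Qed.

(** Entry (i, j) of A *m B is the inner product of a row of A and a column of
    B, so Cauchy-Schwarz applies entrywise. *)
Lemma frobM (R : realType) (p r s : nat)
    (A : 'M[R]_(p, r)) (B : 'M[R]_(r, s)) :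
  frob (A *m B) <= frob A * frob B.
Proof.
rewrite -(@ler_pXn2r _ 2) ?nnegrE ?mulr_ge0 ?frob_ge0 // exprMn.
rewrite -(frob_trmx B) !frob_sq !mxdotE mulr_suml; apply: ler_sum => i _.
rewrite mulr_sumr; apply: ler_sum => j _.
have := mxdot_CauchySchwarz (row i A) (row j B^T).
rewrite !mxdotE !big_ord1 -expr2.
have -> : (A *m B) i j = \sum_l row i A 0 l * row j B^T 0 l.
  by rewrite mxE; apply: eq_bigr => l _; rewrite !mxE.
congr (_ <= _ * _); apply: eq_bigr => l _; first by rewrite mxE.
by rewrite [row _ _ _ _]mxE.
Qed.

(** The coordinates of A X are the inner products of X with the matrices
    A^* e_i, so a linear map into R^m is bounded by their norms. *)
Lemma frob_linear_le (R : realType) (n m : nat)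
    (A : {linear symmx R n -> 'cV[R]_m}) (X : symmx R n) :
  frob (A X) <= Num.sqrt (\sum_i frob (adjoint A (delta_mx i 0)) ^+ 2)
              * frob X.
Proof.
rewrite -(@ler_pXn2r _ 2) ?nnegrE ?mulr_ge0 ?frob_ge0 ?sqrtr_ge0 // exprMn.
rewrite !frob_sq sqr_sqrtr; last by apply: sumr_ge0 => i _; exact: sqr_ge0.
rewrite mxdotE mulr_suml; apply: ler_sum => i _.
rewrite big_ord1 -expr2.
have -> : A X i 0 = mxdot X (adjoint A (delta_mx i 0)).
  rewrite -adjointP mxdotE; under eq_bigr do rewrite big_ord1.
  rewrite (bigD1 i) //= big1 => [|j ji]; first by rewrite mxE !eqxx mulr1 addr0.
  by rewrite mxE (negbTE ji) mulr0.
by rewrite mulrC frob_sq mxdot_CauchySchwarz.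
Qed.

(** * The direct sum of the factor spaces *)

Lemma dsnorm_ge0 (R : realType) (q : nat) (n k : 'I_q -> nat)
  (F : dsum R n k) : 0 <= dsnorm F.
Proof. exact: sqrtr_ge0. Qed.

Lemma dsnorm_sqE (R : realType) (q : nat) (n k : 'I_q -> nat)
  (F : dsum R n k) : dsnorm F ^+ 2 = \sum_c frob (F c) ^+ 2.
Proof. by rewrite sqr_sqrtr // sumr_ge0 // => c _; exact: sqr_ge0. Qed.

Lemma frob_le_dsnorm (R : realType) (q : nat) (n k : 'I_q -> nat)
  (F : dsum R n k) (c : 'I_q) : frob (F c) <= dsnorm F.
Proof.
rewrite -(@ler_pXn2r _ 2) ?nnegrE ?frob_ge0 ?dsnorm_ge0 // dsnorm_sqE.
by rewrite (bigD1 c) //= lerDl sumr_ge0 // => i _; exact: sqr_ge0.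
Qed.

(** * Gram matrices *)

Lemma gram_psd (R : realType) (n k : nat) (F : 'M[R]_(n, k)) : psd (gram F).
Proof.
move=> v; have -> : mxdot v (gram F *m v) = mxdot (F^T *m v) (F^T *m v).
  by rewrite /mxdot trmx_mul trmxK !mulmxA.
exact: mxdot_ge0.
Qed.

Lemma gram_increment (R : realType) (n k : nat) (F H : 'M[R]_(n, k)) :
  gram (F + H) - gram F = F *m H^T + H *m F^T + H *m H^T :> 'M[R]_n.
Proof.
rewrite linearB /= [(F + H)^T]linearD /= mulmxDl !mulmxDr; set A := F *m F^T.
by rewrite [LHS]addrC -!addrA addKr.
Qed.

Lemma frob_gram_increment (R : realType) (n k : nat) (F H : 'M[R]_(n, k)) :
  frob (gram (F + H) - gram F : 'M[R]_n)
    <= 2 * frob F * frob H + frob H ^+ 2.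
Proof.
rewrite gram_increment.
have h1 := frobD (F *m H^T + H *m F^T) (H *m H^T).
have h2 := frobD (F *m H^T) (H *m F^T).
have := frobM F H^T; have := frobM H F^T; have := frobM H H^T.
rewrite !frob_trmx; lra.
Qed.

(** Symmetry of S identifies the two cross terms. *)
Lemma mxdot_gram_increment (R : realType) (n k : nat) (S : symmx R n)
    (F H : 'M[R]_(n, k)) :
  mxdot S (gram (F + H) - gram F : 'M[R]_n)
    = mxdot (2 *: (S *m F)) H + mxdot S (H *m H^T).
Proof.
have St : S^T = S := symmetricmxP _ (symmxP S).
rewrite gram_increment !mxdotDr mxdotZl.
have e : mxdot S (H *m F^T) = mxdot (S *m F) H.
  by rewrite /mxdot trmx_mul St mulmxA mxtrace_mulC mulmxA.
have -> : mxdot S (F *m H^T) = mxdot S (H *m F^T).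
  by rewrite /mxdot -mxtrace_tr !trmx_mul !trmxK mxtrace_mulC St.
by rewrite e; ring.
Qed.

(** * The gradient of the augmented Lagrangian *)

(** Moving A_c^* across the inner product turns the multiplier term of the
    Lagrangian into the slack. *)
Lemma mxdot_slack (R : realType) (q m : nat) (n : 'I_q -> nat)
    (P : product_sdp R m n) (y : 'cV[R]_m) (c : 'I_q) (X : symmx R (n c)) :
  mxdot (slack P y c) X = mxdot (sdp_C P c) X - mxdot y (sdp_A P c X).
Proof. by rewrite /= mxdotBl (mxdotC y) adjointP (mxdotC X). Qed.

Lemma infeas_increment (R : realType) (q m : nat) (n k : 'I_q -> nat)
    (P : product_sdp R m n) (F H : dsum R n k) :
  infeas P (fun c => F c + H c)
    = infeas P F + \sum_c sdp_A P c (gram (F c + H c) - gram (F c)).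
Proof.
rewrite /infeas; under [X in _ = _ + X]eq_bigr do rewrite linearB.
by rewrite sumrB [RHS]addrC addrA subrK.
Qed.

(** The first-order changes of the multiplier term and of the penalty combine
    into - <y - rho c(F), .>, which is why the slack is taken at the updated
    multiplier. *)
Lemma auglag_increment (R : realType) (q m : nat) (n k : 'I_q -> nat)
    (P : product_sdp R m n) (rho : R) (y : 'cV[R]_m) (F H : dsum R n k) :
  auglag P rho y (fun c => F c + H c) - auglag P rho y F
    = \sum_c mxdot (slack P (y - rho *: infeas P F) c)
               (gram (F c + H c) - gram (F c) : symmx R (n c))
      + rho / 2
        * frob (\sum_c sdp_A P c (gram (F c + H c) - gram (F c))) ^+ 2.
Proof.
rewrite /auglag infeas_increment.
set D := \sum_c sdp_A P c _.
under [X in _ = X + _]eq_bigr do rewrite mxdot_slack.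
rewrite sumrB -mxdot_sumr -/D.
under [X in _ = X - _ + _]eq_bigr do rewrite [mxdot _ _]mxdotBr.
rewrite sumrB; move: D (infeas P F) => D c0 /=.
rewrite mxdotBl mxdotZl !frob_sq !mxdotDl !mxdotDr (mxdotC D c0).
by field.
Qed.

(** With h = |H| <= 1, the increment D_c of F_c F_c^T satisfies
    |D_c| <= (2 |F_c| + 1) h, so the penalty term is at most |rho|/2 (K h)^2,
    and <S_c, H_c H_c^T> <= |S_c| h^2.  The remainder is therefore at most
    M h^2, which is below e h as soon as h <= e / (M + 1); the 1 avoids a
    division by zero. *)
Lemma is_gradient_auglag (R : realType) (q m : nat) (n k : 'I_q -> nat)
    (P : product_sdp R m n) (rho : R) (y : 'cV[R]_m) (F : dsum R n k) :
  is_gradient (auglag P rho y) F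
    (fun c => 2 *: (slack P (y - rho *: infeas P F) c *m F c)).
Proof.
set S := slack P _; set G := (X in is_gradient _ _ X) => e e_gt0.
pose a c := Num.sqrt (\sum_i frob (adjoint (sdp_A P c) (delta_mx i 0)) ^+ 2).
pose s := \sum_c frob (S c).
pose K := \sum_c a c * (2 * frob (F c) + 1).
pose M := s + `|rho| / 2 * K ^+ 2.
have s_ge0 : 0 <= s by apply: sumr_ge0 => c _; exact: frob_ge0.
have M_ge0 : 0 <= M.
  by rewrite addr_ge0 // mulr_ge0 ?sqr_ge0 // divr_ge0.
have M1_gt0 : 0 < M + 1 by rewrite ltr_wpDl.
exists (Num.min 1 (e / (M + 1))) => [|H].
  by rewrite lt_min ltr01 divr_gt0.
rewrite le_min ler_pdivlMr // => /andP[h_le1 h_lee].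
have h_ge0 := dsnorm_ge0 H; set h := dsnorm H in h_le1 h_lee h_ge0 *.
rewrite auglag_increment -/S.
set D := \sum_c sdp_A P c _.
have -> : \sum_c mxdot (S c) (gram (F c + H c) - gram (F c) : symmx R (n c))
          = dsdot G H + \sum_c mxdot (S c) (H c *m (H c)^T).
  rewrite -big_split; apply: eq_bigr => c _; exact: mxdot_gram_increment.
rewrite addrAC [_ + _ - dsdot G H]addrC addrA addNr add0r.
have quad : `|\sum_c mxdot (S c) (H c *m (H c)^T)| <= s * h ^+ 2.
  apply: le_trans (ler_norm_sum _ _ _) _; rewrite mulr_suml.
  apply: ler_sum => c _; apply: le_trans (normr_mxdot_le _ _) _.
  rewrite ler_wpM2l ?frob_ge0 //; apply: le_trans (frobM _ _) _.
  by rewrite frob_trmx -expr2 lerXn2r ?nnegrE ?frob_ge0 ?frob_le_dsnorm.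
have D_le : frob D <= K * h.
  apply: le_trans (frob_sum _) _; rewrite mulr_suml; apply: ler_sum => c _.
  apply: le_trans (frob_linear_le _ _) _; rewrite -mulrA.
  rewrite ler_wpM2l ?sqrtr_ge0 //; apply: le_trans (frob_gram_increment _ _) _.
  have Hc := frob_le_dsnorm H c; have Hc0 := frob_ge0 (H c).
  have Fc0 := frob_ge0 (F c); rewrite -/h in Hc.
  have : 0 <= frob (F c) * (h - frob (H c)) by rewrite mulr_ge0 // subr_ge0.
  have : 0 <= frob (H c) * (1 - frob (H c)).
    by rewrite mulr_ge0 // subr_ge0 (le_trans Hc).
  rewrite expr2; lra.
have pen : `|rho / 2 * frob D ^+ 2| <= `|rho| / 2 * K ^+ 2 * h ^+ 2.
  rewrite normrM (normrM rho) normfV (ger0_norm (sqr_ge0 _)).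
  rewrite (ger0_norm (ler0n R 2)) -[leRHS]mulrA -exprMn.
  rewrite ler_wpM2l ?divr_ge0 // lerXn2r ?nnegrE ?frob_ge0 //.
  exact: le_trans (frob_ge0 _) D_le.
apply: le_trans (ler_normD _ _) _; apply: le_trans (lerD quad pen) _.
rewrite -mulrDl -/M expr2 mulrA ler_wpM2r //.
by apply: le_trans h_lee; rewrite mulrC ler_wpM2l // lerDl.
Qed.

Lemma gradient_auglag (R : realType) (q m : nat) (n k : 'I_q -> nat)
    (P : product_sdp R m n) (rho : R) (y : 'cV[R]_m) (F : dsum R n k) :
  gradient (auglag P rho y) F
    = fun c => 2 *: (slack P (y - rho *: infeas P F) c *m F c).
Proof. exact/gradient_unique/is_gradient_auglag. Qed.

(** * Complementarity residual *)

(** Block c of the residual is (S_c F_c) F_c^T, whose norm is at most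
    |S_c F_c| |F_c|; bounding each |F_c| by the norm of the whole factor leaves
    a sum of squares that is a quarter of the squared norm of (2 S_c F_c)_c. *)
Lemma residual_le (R : realType) (q : nat) (n k : 'I_q -> nat)
    (S : forall c, symmx R (n c)) (F : dsum R n k) :
  Num.sqrt (\sum_c frob (S c *m gram (F c)) ^+ 2)
    <= dsnorm F * dsnorm (fun c => 2 *: (S c *m F c)) / 2.
Proof.
set G : dsum R n k := fun c => _.
have rhs_ge0 : 0 <= dsnorm F * dsnorm G / 2.
  by rewrite divr_ge0 ?mulr_ge0 ?dsnorm_ge0.
rewrite -(ger0_norm rhs_ge0) -sqrtr_sqr ler_wsqrtr // !exprMn (dsnorm_sqE G).
rewrite mulr_sumr mulr_suml; apply: ler_sum => c _.
have -> : frob (G c) ^+ 2 = 4 * frob (S c *m F c) ^+ 2.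
  by rewrite !frob_sq mxdotZl mxdotZr; ring.
have -> : dsnorm F ^+ 2 * (4 * frob (S c *m F c) ^+ 2) * 2^-1 ^+ 2
          = (frob (S c *m F c) * dsnorm F) ^+ 2 by field.
rewrite lerXn2r ?nnegrE ?mulr_ge0 ?frob_ge0 ?dsnorm_ge0 //.
rewrite mulmxA; apply: le_trans (frobM _ _) _.
by rewrite frob_trmx ler_wpM2l ?frob_ge0 ?frob_le_dsnorm.
Qed.

Unset Implicit Arguments.

Theorem proposition4 (R : realType) (q m : nat) (n k : 'I_q -> nat)
  (q_gt0 : (0 < q)%N) (m_gt0 : (0 < m)%N)
  (n_gt0 : forall c, (0 < n c)%N) (k_gt0 : forall c, (0 < k c)%N)
  (P : product_sdp R m n) (F : dsum R n k)
  (y_base y_out : 'cV[R]_m) (rho : R)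
  (delta_feas omega tau_dual R_F : R)
  (rho_gt0 : 0 < rho)
  (y_outE : y_out = y_base - rho *: infeas P F)
  (feasF : frob (infeas P F) <= delta_feas)
  (gradF : dsnorm (gradient (auglag P rho y_base) F) <= omega)
  (dualF : forall c,
    loewner_le (- tau_dual *: sym1 R (n c)) (slack P y_out c))
  (normF : dsnorm F <= R_F) :
  approx_optimal P delta_feas (R_F * omega / 2) tau_dual
    (fun c => gram (F c)) y_out.
Proof.
split=> // [c|].
  by rewrite /loewner_le subr0; exact: gram_psd.
apply: le_trans (residual_le _ _) _; rewrite ler_pM2r ?invr_gt0 //.
apply: ler_pM => //; [exact: dsnorm_ge0 | exact: dsnorm_ge0 |].
by rewrite y_outE -gradient_auglag.
Qed.
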